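(* Let $(p,\mathcal E)$ be a framework in $\mathbb R^d$ with data $\mathcal C,\mathcal V,\omega,\lambda,\kappa,\mu_0,L,\bar\mu$ as described in the context. Let $$\eta_1=\frac{4|\omega^TR(p)|}{\lambda},\qquad D=\frac{\eta_1}{L}\Big(\bar\mu^{1/2}+\frac{\eta_1}{L}\Big),$$ and suppose that $$D<\frac19\Big(\frac83+\bar\mu^{1/2}\Big(\bar\mu+\frac83\Big)^{1/2}-\bar\mu\Big).$$ Define $$\eta_3=\frac L2\Big(\Big(\bar\mu+\frac83\Big)^{1/2}-\bar\mu^{1/2}\Big),$$ $$e_{\min}(\eta)=\begin{cases}\sqrt{\big(\frac{|\omega|}{\kappa}\big)^2+\frac23\frac\lambda\kappa\eta^2\big(1-\frac32\frac{\eta_1}{\eta}\big)}-\frac{|\omega|}{\kappa}&\text{if }\kappa>0,\\[1mm] \frac13\frac{\lambda}{|\omega|}\eta^2\big(1-\frac32\frac{\eta_1}{\eta}\big)&\text{if }\kappa=0,\end{cases}\qquad e_{\min}^*=e_{\min}(\eta_3).$$ For a configuration $q$ let $e(q)=(|q_i-q_j|^2)_{(i,j)\in\mathcal E}\in\mathbb R^m$ be its vector of squared edge lengths. Then: (a) $\eta_3>\frac32\eta_1$; (b) if $q\in\mathcal C^p$ and $\eta=|q-p|$ satisfies $\frac32\eta_1<\eta\le\eta_3$, then $|e(q)-e(p)|\ge e_{\min}(\eta)$; (c) if $p$ is deformed continuously, along a path in $\mathcal C^p$, to some configuration $q\in\mathcal C^p$ with $e(q)=e(p)$ and $|q-p|>\frac32\eta_1$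 (so that $|q-p|\ge\eta_2$, with $\eta_2$ as in the context), then there is some point $q'$ on the path at which $|e(q')-e(p)|\ge e_{\min}^*$.
   Context: A framework $(p,\mathcal E)$ in $\mathbb R^d$ consists of a configuration $p=(p_1,\dots,p_n)\in\mathbb R^{dn}$, $p_i\in\mathbb R^d$, and the set $\mathcal E$ of $m$ edges of a graph on vertices $1,\dots,n$. $|\cdot|$ is the Euclidean norm. For $q\in\mathbb R^{dn}$ the rigidity matrix $R(q)\in\mathbb R^{m\times dn}$ is defined by: the $(i,j)$-component of $R(q)u$ is $(q_i-q_j)\cdot(u_i-u_j)$ for $u\in\mathbb R^{dn}$, $(i,j)\in\mathcal E$. A stress is a vector $\omega\in\mathbb R^m$ with components $\omega_{ij}$; its stress matrix $\Omega=\Omega(\omega)\in\mathbb R^{dn\times dn}$ is the symmetric matrix with $u^T\Omega v=\sum_{(i,j)\in\mathcal E}\omega_{ij}(u_i-u_j)\cdot(v_i-v_j)$. $\mathcal T(p)$ is the space of trivial flexes at $p$ (velocities of infinitesimal rigid-body motions, $v_i=Ap_i+b$ with $A$ skew-symmetric, $b\in\mathbb R^d$). Data: $\mathcal C\subset\mathbb R^{dn}$ is a linear subspace complementary to $\mathcal T(p)$, and $\mathcal C^p=\{p+v:v\in\mathcal C\}$. $\mathcal V$ is a linear subspace with $\mathrm{Null}(R(p))\cap\mathcal C\subset\mathcal V\subset\mathcal C$. $\omega\in\mathbb R^m$ is a stress such that $V^T\Omega V\succ0$, where the columns of $V$ are an orthonormal basis of $\mathcal V$. Let $C$ be a matrix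 whose columns form an orthonormal basis of $\mathcal C$. Let $\lambda_0=\lambda_{\min}(V^T\Omega V)$ ($\lambda_0=+\infty$ if $\mathcal V=\{0\}$, in which case the condition on $\omega$ is vacuous) and $\mu_0=\lambda_{\min}(C^T\Omega C)$, where $\lambda_{\min}$ is the smallest eigenvalue. Choose $\lambda\in(0,\lambda_0)$, and let $\kappa$ be the smallest $\kappa\ge0$ such that $C^T\Omega C+2\kappa C^TR(p)^TR(p)C\succeq\lambda I$ (it exists). Let $z$ be the maximum degree of a vertex of the graph, and $L=\left(\frac{\lambda}{8z\kappa}\right)^{1/2}$, $\bar\mu=1-\frac{\mu_0}{\lambda}$. If $\kappa=0$ then $L=+\infty$, all terms with a factor $1/L$ are $0$ (so $D=0$, and the hypothesis on $D$ is regarded as satisfied), and $\eta_2=\eta_3=e_{\min}^*=+\infty$. The radius $\eta_2$ is $\eta_2=L\frac{(\bar\mu+4)^{1/2}-\bar\mu^{1/2}}{2}-\eta_1$ if $D<\frac14+\frac18(\bar\mu^{1/2}(\bar\mu+4)^{1/2}-\bar\mu)$, and $\eta_2=L\frac{(\bar\mu+2)^{1/2}-\bar\mu^{1/2}}{2}$ otherwise. *)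

(* Defs.v *)
From HB Require Import structures.
From mathcomp Require Import all_boot all_order all_algebra.
From mathcomp Require Import ring.
From mathcomp Require Import all_classical all_reals all_analysis.
Set Implicit Arguments.
Unset Strict Implicit.
Unset Printing Implicit Defensive.
Import Order.TTheory GRing.Theory Num.Theory.
Import numFieldNormedType.Exports.
Local Open Scope ring_scope.

Definition dot (R : realType) (k : nat) (u v : 'cV[R]_k) : R :=
  \sum_i u i 0 * v i 0.

(* The library norm on matrices is the sup norm. *)
Definition enorm (R : realType) (k : nat) (u : 'cV[R]_k) : R :=
  Num.sqrt (dot u u).

(* A configuration (p_1, ..., p_n), with p_i in R^d, is a column vector of
   length n * d; the blocks follow the row-major order of mxvec. *)
Definition point (R : realType) (n d : nat) (q : 'cV[R]_(n * d)) (i : 'I_n) :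
  'cV[R]_d := \col_k q (mxvec_index i k) 0.

Section Graph.
Variables (n : nat) (adj : rel 'I_n).

(* Each undirected edge {i, j} is listed once, as (i, j) with i < j. *)
Definition edges : {set 'I_n * 'I_n} :=
  [set ij : 'I_n * 'I_n | adj ij.1 ij.2 && (ij.1 < ij.2)%N].

Definition edge (k : 'I_#|edges|) : 'I_n * 'I_n := enum_val k.

Definition max_degree : nat := (\max_(i < n) #|adj i|)%N.

End Graph.

Section Framework.
Variables (R : realType) (n d : nat) (adj : rel 'I_n).
Implicit Types (p q u v : 'cV[R]_(n * d)) (omega : 'cV[R]_#|edges adj|).

(* u_i - u_j for the k-th edge (i, j) *)
Definition ediff u (k : 'I_#|edges adj|) : 'cV[R]_d :=
  point u (edge k).1 - point u (edge k).2.

Definition sq_lengths q : 'cV[R]_#|edges adj| :=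
  \col_k enorm (ediff q k) ^+ 2.

(* Entries are read off on the standard basis vectors; rigidity_mxE below is
   the defining property. *)
Definition rigidity_mx q : 'M[R]_(#|edges adj|, n * d) :=
  \matrix_(k, a) dot (ediff q k) (ediff (delta_mx a 0) k).

(* The matrix of the bilinear form
   (u, v) |-> \sum_(i,j) omega_ij (u_i - u_j) . (v_i - v_j), see stress_mxE. *)
Definition stress_mx omega : 'M[R]_(n * d) :=
  \matrix_(a, b) \sum_k
    omega k 0 * dot (ediff (delta_mx a 0) k) (ediff (delta_mx b 0) k).

Lemma dotC (k : nat) (u v : 'cV[R]_k) : dot u v = dot v u.
Proof. by apply: eq_bigr => i _; rewrite mulrC. Qed.

Lemma dot_sumr (k : nat) (I : finType) (c : I -> R) (w : 'cV[R]_k)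
    (x : I -> 'cV[R]_k) :
  dot w (\sum_a c a *: x a) = \sum_a c a * dot w (x a).
Proof.
rewrite /dot; under [RHS]eq_bigr do rewrite mulr_sumr.
rewrite exchange_big; apply: eq_bigr => i _ /=.
by rewrite summxE mulr_sumr; apply: eq_bigr => a _; rewrite !mxE mulrCA.
Qed.

Lemma ediff_basis u k :
  ediff u k = \sum_a u a 0 *: ediff (delta_mx a 0) k.
Proof.
apply/matrixP => i j; rewrite summxE !mxE.
under eq_bigr do rewrite !mxE mulrBr.
rewrite big_split /= sumrN; congr (_ - _).
  rewrite (bigD1 (mxvec_index (edge k).1 i)) //= !eqxx mulr1 big1 ?addr0 //.
  by move=> a /negPf na; rewrite eq_sym na mulr0.
rewrite (bigD1 (mxvec_index (edge k).2 i)) //= !eqxx mulr1 big1 ?addr0 //.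
by move=> a /negPf na; rewrite eq_sym na mulr0.
Qed.

Lemma rigidity_mxE q u k :
  (rigidity_mx q *m u) k 0 = dot (ediff q k) (ediff u k).
Proof.
rewrite (ediff_basis u) dot_sumr mxE.
by apply: eq_bigr => a _; rewrite mxE mulrC.
Qed.

Lemma stress_mxE omega u v :
  (u^T *m stress_mx omega *m v) 0 0 =
  \sum_k omega k 0 * dot (ediff u k) (ediff v k).
Proof.
under [RHS]eq_bigr => k _.
  rewrite (ediff_basis v) dot_sumr mulr_sumr.
  under eq_bigr => b _ do
    rewrite dotC (ediff_basis u) dot_sumr mulr_sumr mulr_sumr.
  over.
rewrite exchange_big mxE; apply: eq_bigr => b _ /=.
rewrite mxE mulr_suml exchange_big; apply: eq_bigr => a _ /=.
rewrite !mxE mulr_sumr mulr_suml; apply: eq_bigr => k _.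
by rewrite [dot (ediff (delta_mx b 0) k) _]dotC; ring.
Qed.

Definition trivial_flex p v : Prop :=
  exists (A : 'M[R]_d) (b : 'cV[R]_d),
    A^T = - A /\ forall i, point v i = A *m point p i + b.

Local Open Scope classical_set_scope.

Definition complementary (U : {vspace 'cV[R]_(n * d)})
    (T : set 'cV[R]_(n * d)) : Prop :=
  (forall u, exists c t, [/\ c \in U, T t & u = c + t]) /\
  (forall u, u \in U -> T u -> u = 0).

Definition translate p (U : {vspace 'cV[R]_(n * d)}) : set 'cV[R]_(n * d) :=
  [set p + v | v in [set v | v \in U]].

End Framework.

Section Matrices.
Local Open Scope classical_set_scope.
Variables (R : realType).

Definition orthonormal_basis (N k : nat) (U : {vspace 'cV[R]_N})
    (M : 'M[R]_(N, k)) : Prop :=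
  basis_of U [seq col j M | j <- enum 'I_k] /\ M^T *m M = 1%:M.

Definition psdmx (k : nat) (A : 'M[R]_k) : Prop :=
  A^T = A /\ forall x : 'cV[R]_k, 0 <= (x^T *m A *m x) 0 0.

Definition pdmx (k : nat) (A : 'M[R]_k) : Prop :=
  A^T = A /\ forall x : 'cV[R]_k, x != 0 -> 0 < (x^T *m A *m x) 0 0.

(* Smallest eigenvalue; the spectrum is finite, so the infimum is a minimum as
   soon as there is an eigenvalue (e.g. A symmetric of size k > 0), and it is
   +oo for k = 0. *)
Definition lambda_min (k : nat) (A : 'M[R]_k) : \bar R :=
  ereal_inf [set a%:E | a in [set a : R | eigenvalue A a]].

End Matrices.

(* In the definitions below normw stands for |omega|. *)
Section Radii.
Variable R : realType.
Implicit Types lambda kappa mubar eta normw : R.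

(* Used for kappa > 0.  For kappa = 0, where L should be +oo, division by zero
   gives L = 0 and x / L = 0, so that D = 0 as it should be. *)
Definition Lscale lambda kappa (z : nat) : R :=
  Num.sqrt (lambda / (8 * z%:R * kappa)).

Definition Dconst (L mubar eta1 : R) : R :=
  eta1 / L * (Num.sqrt mubar + eta1 / L).

Definition eta2_radius kappa (L mubar eta1 : R) : \bar R :=
  if kappa == 0 then +oo%E
  else if Dconst L mubar eta1 <
      1 / 4 + 1 / 8 * (Num.sqrt mubar * Num.sqrt (mubar + 4) - mubar)
  then (L * ((Num.sqrt (mubar + 4) - Num.sqrt mubar) / 2) - eta1)%:E
  else (L * ((Num.sqrt (mubar + 2) - Num.sqrt mubar) / 2))%:E.

Definition eta3_val (L mubar : R) : R :=
  L / 2 * (Num.sqrt (mubar + 8 / 3) - Num.sqrt mubar).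

Definition eta3_radius kappa (L mubar : R) : \bar R :=
  if kappa == 0 then +oo%E else (eta3_val L mubar)%:E.

Definition emin lambda kappa normw (eta1 : R) eta : R :=
  if kappa == 0 then
    1 / 3 * (lambda / normw) * eta ^+ 2 * (1 - 3 / 2 * (eta1 / eta))
  else
    Num.sqrt ((normw / kappa) ^+ 2
              + 2 / 3 * (lambda / kappa) * eta ^+ 2
                * (1 - 3 / 2 * (eta1 / eta)))
    - normw / kappa.

Definition emin_star lambda kappa normw (L mubar eta1 : R) : \bar R :=
  if kappa == 0 then +oo%E
  else (emin lambda kappa normw eta1 (eta3_val L mubar))%:E.

End Radii.

(* Main.v *)
Require Import Defs.
From HB Require Import structures.
From mathcomp Require Import all_boot all_order all_algebra.
From mathcomp Require Import ring lra.
From mathcomp Require Import all_classical all_reals all_analysis.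
Set Implicit Arguments.
Unset Strict Implicit.
Unset Printing Implicit Defensive.
Import Order.TTheory GRing.Theory Num.Theory.
Import numFieldNormedType.Exports.
Local Open Scope classical_set_scope.
Local Open Scope ring_scope.

(** For q = p + v with v in the complement of the trivial flexes, consider the
    energy
      H(q) = omega.(e(q) - e(p)) + (kappa/2) |e(q) - e(p)|^2.
    Since e(p + v) - e(p) = 2 R(p) v + e(v), expanding H gives a linear part
    2 omega.R(p)v, which eta1 controls, a quadratic part
    v.Wv + 2 kappa |R(p)v|^2 >= lambda |v|^2 (W the stress matrix; this is the
    choice of kappa), and a remainder driven by
    |e(v)|^2 <= 4 z |v|^4 (enorm_sq_lengths_le); L is the length scale at which
    the remainder competes with lambda |v|^2.

    Up to radius eta3 the remainder uses up at most two thirds of lambda |v|^2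
    (energy_scalar_lb), whence
      H(q) >= (lambda/3) (|v|^2 - (3/2) eta1 |v|)       (energy_growth).
    On the other hand H(q) <= |omega| y + (kappa/2) y^2 with y = |e(q) - e(p)|.
    Solving this quadratic inequality for y is the bound e_min of part (b).
    The lower bound v.Wv >= mu0 |v|^2 used on the way is the Rayleigh
    characterization of the smallest eigenvalue (lambda_min_form), and the
    minimality of kappa makes mubar nonnegative when kappa > 0.

    Part (a) is scalar: eta3 / L is the positive root of
    X^2 + X sqrt(mubar) = 2/3, and the hypothesis on D says that eta1 / L lies
    below 2/3 of this root.

    For part (c), if e(q) = e(p) and |v| > (3/2) eta1, then 2 R(p)v = - e(v) and
    v.Wv = - 2 omega.R(p)v, so the stiffness inequality becomes a comparison of
    lambda |v|^2 with a quartic term; it forces kappa > 0 and |v|^2 > (8/3) L^2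
    (equilibrium_far).  Both eta2 and eta3 are at most L, so |v| exceeds both,
    and the path has a point at distance exactly eta3 from p, where (b)
    applies. *)

(** * Inner products and quadratic forms *)

Section Forms.
Variables (R : realType).

Lemma dotE k (u v : 'cV[R]_k) : dot u v = (u^T *m v) 0 0.
Proof. by rewrite mxE; apply: eq_bigr => i _; rewrite mxE. Qed.

Lemma dotDl k (u v w : 'cV[R]_k) : dot (u + v) w = dot u w + dot v w.
Proof. by rewrite !dotE linearD mulmxDl mxE. Qed.

Lemma dotZl k (c : R) (u v : 'cV[R]_k) : dot (c *: u) v = c * dot u v.
Proof. by rewrite !dotE linearZ -scalemxAl mxE. Qed.

Lemma dotDr k (u v w : 'cV[R]_k) : dot w (u + v) = dot w u + dot w v.
Proof. by rewrite !(dotC w) dotDl. Qed.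

Lemma dotZr k (c : R) (u v : 'cV[R]_k) : dot v (c *: u) = c * dot v u.
Proof. by rewrite !(dotC v) dotZl. Qed.

Lemma dot_ge0 k (u : 'cV[R]_k) : 0 <= dot u u.
Proof. by apply: sumr_ge0 => i _; rewrite -expr2 sqr_ge0. Qed.

Lemma dot_eq0 k (u : 'cV[R]_k) : (dot u u == 0) = (u == 0).
Proof.
apply/idP/idP => [|/eqP ->]; last first.
  by rewrite /dot big1 // => i _; rewrite mxE mul0r.
rewrite /dot psumr_eq0 => [/allP h|i _]; last by rewrite -expr2 sqr_ge0.
apply/eqP/matrixP => i j; rewrite ord1 mxE; apply/eqP.
by have := h i (mem_index_enum i); rewrite -expr2 sqrf_eq0.
Qed.

Lemma dot_gt0 k (u : 'cV[R]_k) : u != 0 -> 0 < dot u u.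
Proof. by rewrite -dot_eq0 lt0r dot_ge0 => ->. Qed.

Lemma enorm_ge0 k (u : 'cV[R]_k) : 0 <= enorm u.
Proof. exact: sqrtr_ge0. Qed.

Lemma sqr_enorm k (u : 'cV[R]_k) : enorm u ^+ 2 = dot u u.
Proof. by rewrite sqr_sqrtr // dot_ge0. Qed.

(** The discriminant argument: a quadratic polynomial that is nonnegative on
    the whole line has a nonpositive discriminant. *)
Lemma discr_le (a b c : R) :
  (forall t, 0 <= a + 2 * t * b + t ^+ 2 * c) -> b ^+ 2 <= a * c.
Proof.
move=> h.
have a0 : 0 <= a by have := h 0; rewrite mulr0 mul0r expr0n mul0r !addr0.
have [c0|c0] := eqVneq c 0.
  have [->|b0] := eqVneq b 0; first by rewrite c0 expr0n mulr0.
  (* a linear polynomial with nonzero slope takes the value -1 *)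
  have := h (- (a + 1) / (2 * b)); rewrite c0.
  have -> : 2 * (- (a + 1) / (2 * b)) * b = - (a + 1) by field.
  lra.
have := h (- b / c).
have -> : a + 2 * (- b / c) * b + (- b / c) ^+ 2 * c = a - b ^+ 2 / c by field.
rewrite subr_ge0.
have cp : 0 < c.
  rewrite lt0r c0 /= leNgt; apply/negP => cn.
  (* for t^2 > a / (- c) the values at t and - t have a negative sum *)
  pose u := (1 + a) / - c.
  have u0 : 0 <= u by rewrite divr_ge0 ?oppr_ge0 ?(ltW cn) //; lra.
  have eu : u * - c = 1 + a by rewrite /u; field; lra.
  by have := h (u + 1); have := h (- (u + 1)); nra.
by rewrite ler_pdivrMr.
Qed.

Lemma form_sym k (B : 'M[R]_k) (x y : 'cV[R]_k) : B^T = B ->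
  (y^T *m B *m x) 0 0 = (x^T *m B *m y) 0 0.
Proof.
move=> sB; transitivity ((y^T *m B *m x)^T 0 0); first by rewrite [RHS]mxE.
by rewrite !trmx_mul trmxK sB mulmxA.
Qed.

Lemma psd_cauchy k (B : 'M[R]_k) (x y : 'cV[R]_k) : psdmx B ->
  (x^T *m B *m y) 0 0 ^+ 2 <= (x^T *m B *m x) 0 0 * (y^T *m B *m y) 0 0.
Proof.
case=> sB pB; apply: discr_le => t.
have -> : (x^T *m B *m x) 0 0 + 2 * t * (x^T *m B *m y) 0 0
    + t ^+ 2 * (y^T *m B *m y) 0 0
    = ((x + t *: y)^T *m B *m (x + t *: y)) 0 0.
  have -> : (x + t *: y)^T = x^T + t *: y^T by rewrite linearD linearZ.
  rewrite !mulmxDl !mulmxDr -!scalemxAl -!scalemxAr.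
  move: (form_sym x y sB); set xx := x^T *m B *m x; set xy := x^T *m B *m y.
  set yx := y^T *m B *m x; set yy := y^T *m B *m y.
  by rewrite !mxE => ->; ring.
exact: pB.
Qed.

Lemma dot_le_enorm k (u v : 'cV[R]_k) : `|dot u v| <= enorm u * enorm v.
Proof.
have h : psdmx (1%:M : 'M[R]_k).
  by split=> [|x]; rewrite ?trmx1 // mulmx1 -dotE dot_ge0.
have := psd_cauchy u v h; rewrite !mulmx1 -!dotE => ?.
rewrite -(@ler_pXn2r _ 2) ?nnegrE ?mulr_ge0 ?enorm_ge0 //.
by rewrite real_normK ?num_real // exprMn !sqr_enorm.
Qed.

Lemma sqr_coord_le k (u : 'cV[R]_k) i : u i 0 ^+ 2 <= dot u u.
Proof.
rewrite /dot (bigD1 i) //= expr2 lerDl.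
by apply: sumr_ge0 => j _; rewrite -expr2 sqr_ge0.
Qed.

Lemma form_bounded k (B : 'M[R]_k) :
  exists2 M : R, 0 < M &
    forall x : 'cV[R]_k, `|(x^T *m B *m x) 0 0| <= M * dot x x.
Proof.
exists (1 + \sum_j \sum_i `|B i j|).
  by rewrite ltr_wpDr // sumr_ge0 // => j _; rewrite sumr_ge0.
move=> x; have -> : (x^T *m B *m x) 0 0 = \sum_j \sum_i x i 0 * B i j * x j 0.
  rewrite mxE; apply: eq_bigr => j _; rewrite mxE mulr_suml.
  by apply: eq_bigr => i _; rewrite mxE.
apply: (le_trans (ler_norm_sum _ _ _)).
apply: (@le_trans _ _ ((\sum_j \sum_i `|B i j|) * dot x x)); last first.
  by rewrite ler_wpM2r ?dot_ge0 // lerDr.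
rewrite mulr_suml; apply: ler_sum => j _.
apply: (le_trans (ler_norm_sum _ _ _)); rewrite mulr_suml.
apply: ler_sum => i _; rewrite mulrAC normrM mulrC ler_wpM2l //.
have := sqr_coord_le x i; have := sqr_coord_le x j.
rewrite ler_norml => ? ?.
have := sqr_ge0 (x i 0 - x j 0); have := sqr_ge0 (x i 0 + x j 0).
by rewrite sqrrD sqrrB => ? ?; apply/andP; split; lra.
Qed.

(** With |Bx|^2 = x.B(Bx), Cauchy-Schwarz for the form of B gives
    |Bx|^4 <= (x.Bx)(Bx.B(Bx)) <= M (x.Bx)|Bx|^2, and |x| is controlled by
    |Bx| because B is invertible. *)
Lemma psd_unit_coercive k (B : 'M[R]_k) : psdmx B -> B \in unitmx ->
  exists2 c : R, 0 < c &
    forall x : 'cV[R]_k, c * dot x x <= (x^T *m B *m x) 0 0.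
Proof.
move=> hB uB; have [sB pB] := hB.
have [M M0 hM] := form_bounded B.
have [M' M'0 hM'] := form_bounded ((invmx B)^T *m invmx B).
exists ((M * M')^-1) => [|x]; first by rewrite invr_gt0 mulr_gt0.
rewrite mulrC ler_pdivrMr ?mulr_gt0 //.
set y := B *m x.
have inv_le z : dot (invmx B *m z) (invmx B *m z) <= M' * dot z z.
  apply: le_trans (ler_norm _) _; apply: le_trans (hM' z).
  by rewrite dotE trmx_mul !mulmxA.
have xy : dot x x <= M' * dot y y.
  by rewrite -{1 2}(mulKmx uB x); exact: inv_le.
have yy : dot y y = (x^T *m B *m y) 0 0 by rewrite dotE /y trmx_mul sB.
have cs : dot y y ^+ 2 <= (x^T *m B *m x) 0 0 * (M * dot y y).
  rewrite {1}yy; apply: (le_trans (psd_cauchy x y hB)).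
  by rewrite ler_wpM2l ?pB // (le_trans (ler_norm _)).
have yle : dot y y <= (x^T *m B *m x) 0 0 * M.
  have [->|y0] := eqVneq (dot y y) 0; first by rewrite mulr_ge0 ?pB ?ltW.
  have yp : 0 < dot y y by rewrite lt0r y0 dot_ge0.
  by rewrite -(ler_pM2r yp) -expr2 -mulrA.
apply: (le_trans xy); rewrite mulrA [leRHS]mulrC ler_wpM2l //; exact: ltW.
Qed.

Lemma form_shift k (A : 'M[R]_k) (a : R) (x : 'cV[R]_k) :
  (x^T *m (A - a%:M) *m x) 0 0 = (x^T *m A *m x) 0 0 - a * dot x x.
Proof. by rewrite mulmxBr mulmxBl mul_mx_scalar -scalemxAl !mxE dotE mxE. Qed.

(** The Rayleigh bound.  Let m be the largest a for which A - a I is positive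
    semidefinite.  Were A - m I invertible, it would be coercive and m could be
    increased; so m is an eigenvalue, and it bounds all the others from
    below. *)
Lemma lambda_min_form k (A : 'M[R]_k) (x : 'cV[R]_k) : A^T = A -> x != 0 ->
  fine (lambda_min A) * dot x x <= (x^T *m A *m x) 0 0.
Proof.
move=> sA x0.
pose S := [set a : R | forall y : 'cV[R]_k, a * dot y y <= (y^T *m A *m y) 0 0].
have [M M0 hM] := form_bounded A.
have SM : S (- M).
  by move=> y; have := hM y; rewrite ler_norml mulNr => /andP[].
have hS : has_sup S.
  split; first by exists (- M).
  exists ((x^T *m A *m x) 0 0 / dot x x) => a /(_ x).
  by rewrite ler_pdivlMr // dot_gt0.
pose m := sup S.
have Sm : S m.
  move=> y; have [->|y0] := eqVneq y 0.
    by rewrite mulmx0 mxE /dot big1 ?mulr0 // => i _; rewrite mxE mul0r.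
  rewrite -ler_pdivlMr ?dot_gt0 //; apply: ge_sup; first by case: hS.
  by move=> a /(_ y); rewrite ler_pdivlMr // dot_gt0.
have psdm : psdmx (A - m%:M).
  split=> [|y]; first by rewrite linearB /= sA tr_scalar_mx.
  by rewrite form_shift subr_ge0.
have nu : A - m%:M \notin unitmx.
  apply/negP => /(psd_unit_coercive psdm)[c c0 hc].
  have : S (m + c).
    by move=> y; have := hc y; rewrite form_shift mulrDl; lra.
  by move/(sup_upper_bound hS); rewrite -/m gerDl leNgt c0.
have eigm : eigenvalue A m.
  by rewrite /eigenvalue /eigenspace kermx_eq0 row_free_unit.
suff -> : lambda_min A = m%:E by exact: Sm.
apply/eqP; rewrite eq_le; apply/andP; split.
  by apply: ereal_inf_lbound; exists m.
apply: le_ereal_inf_tmp => _ [a /eigenvalueP[v vA v0] <-]; rewrite lee_fin.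
have vT0 : v^T != 0 by rewrite -trmx0 (inj_eq (@trmx_inj _ _ _)).
rewrite -(ler_pM2r (dot_gt0 vT0)); have := Sm v^T.
by rewrite trmxK vA -scalemxAl mxE dotE trmxK.
Qed.

Lemma orthonormal_basis_coord N k (U : {vspace 'cV[R]_N}) (M : 'M[R]_(N, k))
    (v : 'cV[R]_N) :
  orthonormal_basis U M -> v \in U ->
  exists2 x : 'cV[R]_k, v = M *m x & dot v v = dot x x.
Proof.
case=> /andP[/eqP span_U _] onM vU.
suff [x vx] : exists x : 'cV[R]_k, v = M *m x.
  exists x => //; rewrite !dotE vx trmx_mul mulmxA -(mulmxA _ M^T) onM.
  by rewrite mulmx1.
have sz : size [seq col j M | j <- enum 'I_k] == k.
  by rewrite size_map size_enum_ord.
rewrite -span_U in vU; have := @coord_span _ _ _ (Tuple sz) _ vU.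
set c := coord _ => ->; exists (\col_i c i v).
apply/colP => i; rewrite summxE mxE; apply: eq_bigr => j _.
rewrite !mxE mulrC; congr (_ * _).
by rewrite (nth_map j) ?size_enum_ord // nth_ord_enum mxE.
Qed.

End Forms.

(** * Edge lengths *)

Section EdgeLengths.
Variables (R : realType) (n d : nat) (adj : rel 'I_n).
Implicit Types (p q u v : 'cV[R]_(n * d)) (omega : 'cV[R]_#|edges adj|).

Lemma ediffD u v (k : 'I_#|edges adj|) : ediff (u + v) k = ediff u k + ediff v k.
Proof. by apply/matrixP => i j; rewrite !mxE; ring. Qed.

Lemma sq_lengthsD p v :
  sq_lengths adj (p + v) - sq_lengths adj p =
  2 *: (rigidity_mx adj p *m v) + sq_lengths adj v.
Proof.
apply/colP => k.
have -> : (2 *: (rigidity_mx adj p *m v) + sq_lengths adj v) k 0 =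
   2 * dot (ediff p k) (ediff v k) + enorm (ediff v k) ^+ 2.
  by rewrite -rigidity_mxE !mxE.
rewrite !mxE !sqr_enorm ediffD.
move: (ediff p k) (ediff v k) => a b.
by rewrite !(dotDl, dotDr) (dotC b a); ring.
Qed.

Lemma dot_sq_lengths omega v :
  dot omega (sq_lengths adj v) = (v^T *m stress_mx d omega *m v) 0 0.
Proof.
rewrite stress_mxE; apply: eq_bigr => k _.
by rewrite mxE sqr_enorm.
Qed.

Lemma stress_mx_sym omega : (stress_mx d omega)^T = stress_mx d omega.
Proof.
apply/matrixP => a b; rewrite !mxE; apply: eq_bigr => k _.
by rewrite dotC.
Qed.

Lemma dot_point v : dot v v = \sum_i dot (Defs.point v i) (Defs.point v i).
Proof.
rewrite /dot pair_big /=.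
rewrite (reindex (uncurry (@mxvec_index n d))) /=; last first.
  exact: curry_mxvec_bij.
by apply: eq_bigr => -[i j] _ /=; rewrite !mxE.
Qed.

Lemma dot_ediff_le v (k : 'I_#|edges adj|) :
  dot (ediff v k) (ediff v k) <=
  2 * (dot (Defs.point v (edge k).1) (Defs.point v (edge k).1) +
       dot (Defs.point v (edge k).2) (Defs.point v (edge k).2)).
Proof.
rewrite /ediff; set a := Defs.point v _; set b := Defs.point v _.
have := dot_ge0 (a + b).
have -> : a - b = a + (-1) *: b by rewrite scaleN1r.
rewrite !(dotDl, dotDr, dotZl, dotZr) (dotC b a); lra.
Qed.

(** Summing |v_i|^2 + |v_j|^2 over the edges counts each |v_i|^2 once per
    neighbour of i. *)
Lemma sum_edges_le (a : 'I_n -> R) : symmetric adj -> (forall i, 0 <= a i) ->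
  \sum_(k < #|edges adj|) (a (edge k).1 + a (edge k).2) <=
  (max_degree adj)%:R * \sum_i a i.
Proof.
move=> adj_sym a0.
rewrite -(big_enum_val (fun ij : 'I_n * 'I_n => a ij.1 + a ij.2)).
have -> : \sum_(ij in edges adj) (a ij.1 + a ij.2) =
    \sum_i \sum_j ((if adj i j && (i < j)%N then a i else 0)
                  + (if adj i j && (j < i)%N then a i else 0)).
  under [RHS]eq_bigr do rewrite big_split /=.
  rewrite [RHS]big_split /= [X in _ + X]exchange_big !pair_big /= -big_split /=.
  rewrite big_mkcond /=; apply: eq_bigr => -[i j] _ /=.
  by rewrite inE /= (adj_sym j i); case: ifP => // _; rewrite addr0.
rewrite mulr_sumr; apply: ler_sum => i _.
apply: (@le_trans _ _ (#|adj i|%:R * a i)); last first.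
  by rewrite ler_wpM2r // ler_nat /max_degree (leq_bigmax i).
rewrite -sum1_card natr_sum mulr_suml [leRHS]big_mkcond.
apply: ler_sum => j _; rewrite unfold_in.
by case: (adj i j); case: ltngtP => _ /=; rewrite ?addr0 ?add0r ?mul1r.
Qed.

(** Each squared edge length is at most 2 |v|^2 and their sum at most
    2 z |v|^2. *)
Lemma enorm_sq_lengths_le v : symmetric adj ->
  enorm (sq_lengths adj v) ^+ 2 <= 4 * (max_degree adj)%:R * enorm v ^+ 4.
Proof.
move=> adj_sym.
have v4 : enorm v ^+ 4 = dot v v ^+ 2 by rewrite -sqr_enorm -exprM.
rewrite v4 sqr_enorm.
pose a i := dot (Defs.point v i) (Defs.point v i).
have a0 i : 0 <= a i by exact: dot_ge0.
have le1 (k : 'I_#|edges adj|) : dot (ediff v k) (ediff v k) <=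
    2 * (a (edge k).1 + a (edge k).2).
  exact: dot_ediff_le.
have le2 (k : 'I_#|edges adj|) : a (edge k).1 + a (edge k).2 <= dot v v.
  have := enum_valP k; rewrite inE -/(edge k) => /andP[_ lt12].
  rewrite dot_point (bigD1 (edge k).1) //= (bigD1 (edge k).2) /=; last first.
    by rewrite gt_eqF.
  by rewrite addrA lerDl sumr_ge0 // => i _; exact: a0.
apply: (@le_trans _ _ (\sum_k 2 * dot v v * (2 * (a (edge k).1 + a (edge k).2)))).
  apply: ler_sum => k _; rewrite !mxE !sqr_enorm.
  apply: ler_pM; rewrite ?dot_ge0 //.
  by rewrite (le_trans (le1 k)) // ler_wpM2l.
rewrite -mulr_sumr -mulr_sumr.
have := sum_edges_le adj_sym a0; rewrite -dot_point => h.
have -> : 4 * (max_degree adj)%:R * dot v v ^+ 2 =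
  2 * dot v v * (2 * ((max_degree adj)%:R * dot v v)) by ring.
by rewrite ler_wpM2l ?mulr_ge0 ?dot_ge0 // ler_wpM2l.
Qed.

(** The left-hand side is the energy of the configuration p + v: springs along
    the edges whose tensions at p are given by omega.  Its quadratic part is
    the form v.Wv + 2 kappa |R(p) v|^2 to which the stiffness condition
    applies, for W the stress matrix. *)
Lemma energy_expand p v omega (kappa : R) :
  let x := sq_lengths adj (p + v) - sq_lengths adj p in
  let r := rigidity_mx adj p *m v in
  let s := sq_lengths adj v in
  dot omega x + kappa / 2 * dot x x =
  2 * dot omega r + (v^T *m stress_mx d omega *m v) 0 0
  + kappa / 2 * (4 * dot r r + 4 * dot r s + dot s s).
Proof.
rewrite /= sq_lengthsD -dot_sq_lengths.
rewrite !(dotDl, dotDr, dotZl, dotZr).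
by rewrite [dot (sq_lengths adj v) (rigidity_mx _ _ *m _)]dotC; ring.
Qed.

Lemma stress_rigidity_le p v omega :
  `|dot omega (rigidity_mx adj p *m v)| <=
  enorm (omega^T *m rigidity_mx adj p)^T * enorm v.
Proof.
have -> : dot omega (rigidity_mx adj p *m v) =
    dot (omega^T *m rigidity_mx adj p)^T v.
  by rewrite !dotE trmxK mulmxA.
exact: dot_le_enorm.
Qed.

End EdgeLengths.

Lemma enorm_continuous (R : realType) k : continuous (@enorm R k).
Proof.
have cont_dot : continuous (fun u : 'cV[R]_k => dot u u).
  apply: continuous_big => [|i _]; first exact: add_continuous.
  move=> u; have c := @coord_continuous R k 1 i 0 u.
  by apply: continuousM; exact: c.
by move=> u; apply: continuous_comp; [exact: cont_dot|exact: sqrt_continuous].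
Qed.

(** * Scalar estimates *)

Section Scalars.
Variable R : realType.
Implicit Types m s a b r t x y lambda kappa : R.

(** Every radius in the theorem is L times the positive root x of
    X^2 + X sqrt(mubar) = c / 4 for some c, up to the shift by eta1 in eta2. *)
Lemma sqrt_gap m c : 0 <= m -> 0 <= c ->
  let x := (Num.sqrt (m + c) - Num.sqrt m) / 2 in
  0 <= x /\ x ^+ 2 + x * Num.sqrt m = c / 4.
Proof.
move=> m0 c0 /=.
have e1 : Num.sqrt (m + c) ^+ 2 = m + c by rewrite sqr_sqrtr // addr_ge0.
have e2 : Num.sqrt m ^+ 2 = m by rewrite sqr_sqrtr.
split; last by move: e1 e2; set x := Num.sqrt _; set y := Num.sqrt _ => *; nra.
have : Num.sqrt m <= Num.sqrt (m + c) by rewrite ler_sqrt ?lerDl ?addr_ge0.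
lra.
Qed.

Lemma root_lt y s x c : 0 <= y -> 0 <= x -> 0 <= s ->
  x ^+ 2 + x * y = c -> s ^+ 2 + s * y < c -> s < x.
Proof. by move=> *; rewrite ltNge; apply/negP => xs; nra. Qed.

Lemma root_le y s x c : 0 <= y -> 0 <= x -> 0 <= s ->
  x ^+ 2 + x * y = c -> s <= x -> s ^+ 2 + s * y <= c.
Proof. by move=> *; nra. Qed.

(** Here m = mubar, N = |v|, s = N / L, a = v.Wv for the stress matrix W,
    r = |Rv|, t = |e(v)| and c = Rv.e(v), so that the conclusion bounds
    a + (kappa/2) |2Rv + e(v)|^2 from below, by way of |2Rv + e(v)| >= 2r - t.  If a >= lambda N^2 / 3 there is nothing to do.
    Otherwise stiffness forces sqrt(2 kappa) r >= b := sqrt(lambda N^2 - a);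
    the term sqrt(kappa / 2) t is at most b, so the bound is least when r
    attains this value, where it equals
    lambda N^2 - 2 b sqrt(kappa / 2) t + (kappa / 2) t^2.  The middle term is at
    most lambda N^2 s sqrt(mubar), because b <= sqrt(mubar lambda) N. *)
Lemma energy_scalar_lb lambda kappa m (N s a r t c : R) :
  0 < lambda -> 0 < kappa -> 0 <= N -> 0 <= s -> 0 <= r -> 0 <= t ->
  0 <= m ->
  (1 - m) * lambda * N ^+ 2 <= a ->
  lambda * N ^+ 2 <= a + 2 * kappa * r ^+ 2 ->
  - (r * t) <= c ->
  2 * kappa * t ^+ 2 <= lambda * N ^+ 2 * s ^+ 2 ->
  s ^+ 2 + s * Num.sqrt m <= 2 / 3 ->
  lambda * N ^+ 2 / 3 <= a + kappa / 2 * (4 * r ^+ 2 + 4 * c + t ^+ 2).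
Proof.
move=> l0 k0 N0 s0 r0 t0 m0 ha hs hc ht hsm.
have [a3|a3] := lerP (lambda * N ^+ 2 / 3) a.
  apply: (le_trans a3); rewrite lerDl mulr_ge0 //; first by lra.
  have := sqr_ge0 (2 * r - t); nra.
pose k2 := Num.sqrt (kappa / 2).
have k20 : 0 <= k2 by exact: sqrtr_ge0.
have ek2 : k2 ^+ 2 = kappa / 2 by rewrite sqr_sqrtr // divr_ge0 // ltW.
pose b := Num.sqrt (lambda * N ^+ 2 - a).
have b0 : 0 <= b by exact: sqrtr_ge0.
have lN : 0 <= lambda * N ^+ 2 by rewrite mulr_ge0 ?sqr_ge0 // ltW.
have eb : b ^+ 2 = lambda * N ^+ 2 - a by rewrite sqr_sqrtr //; lra.
pose y := Num.sqrt lambda * N.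
have y0 : 0 <= y by rewrite mulr_ge0 // sqrtr_ge0.
have ey : y ^+ 2 = lambda * N ^+ 2 by rewrite exprMn sqr_sqrtr // ltW.
pose sm := Num.sqrt m.
have sm0 : 0 <= sm by exact: sqrtr_ge0.
have esm : sm ^+ 2 = m by rewrite sqr_sqrtr.
rewrite -/sm in hsm.
(* the two norms rescaled so that the kappa term becomes (r' - t')^2 *)
pose r' := 2 * k2 * r; pose t' := k2 * t.
have r'0 : 0 <= r' by rewrite !mulr_ge0.
have t'0 : 0 <= t' by rewrite !mulr_ge0.
have er' : r' ^+ 2 = 2 * kappa * r ^+ 2 by rewrite /r' !exprMn ek2; field.
have et' : t' ^+ 2 = kappa / 2 * t ^+ 2 by rewrite /t' !exprMn ek2.
have ert : r' * t' = kappa * (r * t).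
  have -> : r' * t' = 2 * k2 ^+ 2 * (r * t) by rewrite /r' /t'; ring.
  by rewrite ek2; field.
clearbody y sm b r' t' k2.
have br : b <= r' by rewrite -(@ler_pXn2r _ 2) ?nnegrE // eb er'; lra.
have bm : b <= sm * y.
  rewrite -(@ler_pXn2r _ 2) ?nnegrE ?mulr_ge0 // eb exprMn esm ey.
  move: ha; rewrite !mulrBl !mul1r -mulrA; lra.
have ty : 2 * t' <= s * y.
  rewrite -(@ler_pXn2r _ 2) ?nnegrE ?mulr_ge0 // !exprMn ey et'.
  by move: ht; rewrite [_ * s ^+ 2]mulrC; lra.
have tb : t' <= b.
  rewrite -(@ler_pXn2r _ 2) ?nnegrE // eb.
  have : s ^+ 2 <= 2 / 3 by have := mulr_ge0 s0 sm0; lra.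
  rewrite et' => s2.
  have : lambda * N ^+ 2 * s ^+ 2 <= lambda * N ^+ 2 * (2 / 3) by rewrite ler_wpM2l.
  lra.
have sq : (b - t') ^+ 2 <= (r' - t') ^+ 2.
  by rewrite ler_pXn2r ?nnegrE ?subr_ge0 ?(le_trans tb) // lerB.
have bt : 2 * (b * t') <= 2 / 3 * y ^+ 2.
  have h1 : b * (2 * t') <= (sm * y) * (s * y) by apply: ler_pM; rewrite ?mulr_ge0.
  have h2 : (s * sm) * y ^+ 2 <= 2 / 3 * y ^+ 2.
    rewrite ler_wpM2r ?sqr_ge0 //; have := sqr_ge0 s; lra.
  have h3 : (sm * y) * (s * y) = (s * sm) * y ^+ 2 by ring.
  move: h1 h2; rewrite h3; lra.
have hc' : - (kappa * (r * t)) <= kappa * c by rewrite -mulrN ler_wpM2l // ltW.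
move: sq bt; rewrite !sqrrB eb er' ert ey et'.
have := sqr_ge0 t'; rewrite et'.
have -> : kappa / 2 * (4 * r ^+ 2 + 4 * c + t ^+ 2) =
  2 * (kappa * r ^+ 2) + 2 * (kappa * c) + kappa / 2 * t ^+ 2 by field.
lra.
Qed.

(** The left-hand side is the nonnegative root of the quadratic when Q >= 0;
    with w = |omega| it becomes e_min. *)
Lemma quadratic_lb kappa w y Q : 0 < kappa -> 0 <= w -> 0 <= y ->
  Q <= w * y + kappa / 2 * y ^+ 2 ->
  Num.sqrt ((w / kappa) ^+ 2 + 2 / kappa * Q) - w / kappa <= y.
Proof.
move=> k0 w0 y0 h; rewrite lerBlDr.
have wk : 0 <= w / kappa by rewrite divr_ge0 // ltW.
rewrite -[leRHS]ger0_norm ?addr_ge0 // -sqrtr_sqr ler_sqrt ?sqr_ge0 //.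
have : 2 / kappa * Q <= 2 / kappa * (w * y + kappa / 2 * y ^+ 2).
  by rewrite ler_wpM2l // divr_ge0 // ltW.
have -> : 2 / kappa * (w * y + kappa / 2 * y ^+ 2) = 2 * (w / kappa) * y + y ^+ 2.
  by field; lra.
have -> : (y + w / kappa) ^+ 2 = y ^+ 2 + 2 * (w / kappa) * y + (w / kappa) ^+ 2.
  by ring.
lra.
Qed.

End Scalars.

(** * Growth of the energy *)

Section Growth.
Variables (R : realType) (n d : nat) (adj : rel 'I_n).
Variables (p : 'cV[R]_(n * d)) (omega : 'cV[R]_#|edges adj|).
Variables (lambda kappa : R).
Hypotheses (adj_sym : symmetric adj) (lambda_gt0 : 0 < lambda).
Hypothesis kappa_ge0 : 0 <= kappa.
Let Rp := rigidity_mx adj p.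
Let Omega := stress_mx d omega.
Let z : R := (max_degree adj)%:R.
Let eta1 := 4 * enorm (omega^T *m Rp)^T / lambda.
Let e (q : 'cV[R]_(n * d)) := sq_lengths adj q.

Variable v : 'cV[R]_(n * d).
Let N := enorm v.
Let a := (v^T *m Omega *m v) 0 0.
Hypothesis stiff : lambda * N ^+ 2 <= a + 2 * kappa * enorm (Rp *m v) ^+ 2.

Lemma linear_term_le : `|2 * dot omega (Rp *m v)| <= lambda / 2 * eta1 * N.
Proof.
rewrite normrM ger0_norm //.
have -> : lambda / 2 * eta1 * N = 2 * (enorm (omega^T *m Rp)^T * N).
  by rewrite /eta1; field; exact: lt0r_neq0.
by rewrite ler_wpM2l // stress_rigidity_le.
Qed.

(** The condition on N / L says that |v| <= eta3.  In that range the cubic and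
    quartic parts of the energy cost at most two thirds of the stiffness
    lambda, and the linear part contributes the term in eta1.  The right-hand
    side bounds the energy in terms of the change of the lengths. *)
Lemma energy_growth (m L : R) :
  (0 < kappa -> [/\ 0 <= m, (1 - m) * lambda * N ^+ 2 <= a, 0 < L,
     L ^+ 2 * (8 * z * kappa) = lambda &
     (N / L) ^+ 2 + N / L * Num.sqrt m <= 2 / 3]) ->
  lambda / 3 * (N ^+ 2 - 3 / 2 * eta1 * N) <=
  enorm omega * enorm (e (p + v) - e p) + kappa / 2 * enorm (e (p + v) - e p) ^+ 2.
Proof.
move=> hk.
have N0 : 0 <= N by exact: enorm_ge0.
set x := e (p + v) - e p.
have hx : dot omega x + kappa / 2 * dot x x <=
    enorm omega * enorm x + kappa / 2 * enorm x ^+ 2.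
  by rewrite sqr_enorm lerD2r (le_trans (ler_norm _)) // dot_le_enorm.
apply: le_trans hx; rewrite /x energy_expand -/Rp -/Omega -/a.
have := linear_term_le; rewrite ler_norml => /andP[lin _].
set r := Rp *m v in lin *; set s := sq_lengths adj v.
suff h : lambda * N ^+ 2 / 3 <=
    a + kappa / 2 * (4 * enorm r ^+ 2 + 4 * dot r s + enorm s ^+ 2).
  by move: h; rewrite !sqr_enorm; lra.
have [k0|k0] := eqVneq kappa 0.
  move: stiff; rewrite k0 !(mulr0, mul0r, addr0) => ha.
  have : 0 <= lambda * N ^+ 2 by rewrite mulr_ge0 ?sqr_ge0 // ltW.
  lra.
have kp : 0 < kappa by rewrite lt0r k0.
have [m0 ma L0 eL hs] := hk kp.
apply: (@energy_scalar_lb _ _ _ m N (N / L)) => //; rewrite ?enorm_ge0 //.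
- by rewrite divr_ge0 // ltW.
- by have := dot_le_enorm r s; rewrite ler_norml => /andP[].
- have := enorm_sq_lengths_le v adj_sym; rewrite -/s -/N -/z => sN.
  have -> : lambda * N ^+ 2 * (N / L) ^+ 2 = 2 * kappa * (4 * z * N ^+ 4).
    by rewrite -eL; field; lra.
  by rewrite ler_wpM2l // mulr_ge0 // ltW.
Qed.

(** If e(p + v) = e(p) then 2 R(p) v = - e(v), so the stiffness term is quartic
    in |v|, and it can beat lambda |v|^2 only for |v| of order L. *)
Lemma equilibrium_far :
  e (p + v) = e p -> 3 / 2 * eta1 < N -> lambda < 3 * kappa * z * N ^+ 2.
Proof.
move=> ee hN.
have eta10 : 0 <= eta1 by rewrite divr_ge0 ?mulr_ge0 ?enorm_ge0 // ltW.
have N0 : 0 < N by lra.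
have x0 : e (p + v) - e p = 0 by rewrite ee subrr.
have := linear_term_le; rewrite ler_norml => /andP[lin _].
have rs : 2 *: (Rp *m v) = - e v.
  by apply/eqP; rewrite -addr_eq0 -sq_lengthsD -/e x0.
have ev : e v = - 1 *: (2 *: (Rp *m v)) by rewrite rs scaleN1r opprK.
have a_lin : a = - (2 * dot omega (Rp *m v)).
  by rewrite /a -dot_sq_lengths -/(e v) ev !dotZr mulN1r.
have r4 : 4 * enorm (Rp *m v) ^+ 2 <= 4 * z * N ^+ 4.
  have -> : 4 * enorm (Rp *m v) ^+ 2 = enorm (e v) ^+ 2.
    by rewrite !sqr_enorm ev !(dotZl, dotZr); ring.
  exact: enorm_sq_lengths_le.
have h1 : lambda * N ^+ 2 <= lambda / 2 * eta1 * N + 2 * kappa * (z * N ^+ 4).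
  apply: (le_trans stiff); rewrite a_lin; apply: lerD; first by lra.
  by rewrite ler_wpM2l ?mulr_ge0 //; lra.
have h2 : lambda / 2 * eta1 * N < lambda / 3 * N ^+ 2.
  have -> : lambda / 2 * eta1 * N = (lambda / 3 * N) * (3 / 2 * eta1) by field.
  by rewrite expr2 mulrA ltr_pM2l // mulr_gt0 // divr_gt0.
rewrite -(@ltr_pM2r _ (N ^+ 2)) ?exprn_gt0 //.
have -> : 3 * kappa * z * N ^+ 2 * N ^+ 2 = 3 / 2 * (2 * kappa * (z * N ^+ 4)).
  by field.
lra.
Qed.

End Growth.

(** * Edge-length deviation within the radius eta3 *)

Theorem theorem3 (R : realType) (n d : nat)
  (adj : rel 'I_n) (adj_sym : symmetric adj) (adj_irr : irreflexive adj)
  (p : 'cV[R]_(n * d))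
  (Csp Vsp : {vspace 'cV[R]_(n * d)})
  (hCcompl : complementary Csp [set v | trivial_flex p v])
  (hNullV : forall v, rigidity_mx adj p *m v = 0 -> v \in Csp -> v \in Vsp)
  (hVC : (Vsp <= Csp)%VS)
  (kC kV : nat) (C : 'M[R]_(n * d, kC)) (V : 'M[R]_(n * d, kV))
  (hC : orthonormal_basis Csp C) (hV : orthonormal_basis Vsp V)
  (omega : 'cV[R]_#|edges adj|)
  (homega : pdmx (V^T *m stress_mx d omega *m V))
  (lambda : R) (hlambda0 : 0 < lambda)
  (hlambda : (lambda%:E < lambda_min (V^T *m stress_mx d omega *m V))%E)
  (kappa : R) :
  let Rp := rigidity_mx adj p in
  let Omega := stress_mx d omega in
  let K := [set k : R | 0 <= k /\
    psdmx (C^T *m Omega *m C + (2 * k) *: (C^T *m Rp^T *m Rp *m C)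
           - lambda%:M)] in
  K kappa -> lbound K kappa ->
  (* mu0 is only relevant for kappa > 0, and then Csp is nonzero *)
  let mu0 := fine (lambda_min (C^T *m Omega *m C)) in
  let mubar := 1 - mu0 / lambda in
  let L := Lscale lambda kappa (max_degree adj) in
  let eta1 := 4 * enorm (omega^T *m Rp)^T / lambda in
  let D := Dconst L mubar eta1 in
  (0 < kappa ->
   D < 1 / 9 * (8 / 3 + Num.sqrt mubar * Num.sqrt (mubar + 8 / 3) - mubar)) ->
  let eta2 := eta2_radius kappa L mubar eta1 in
  let eta3 := eta3_radius kappa L mubar in
  let e_min := emin lambda kappa (enorm omega) eta1 in
  let e_min_star := emin_star lambda kappa (enorm omega) L mubar eta1 in
  let e := sq_lengths adj in
  [/\ ((3 / 2 * eta1)%:E < eta3)%E,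
      (forall q : 'cV[R]_(n * d), translate p Csp q ->
        3 / 2 * eta1 < enorm (q - p) -> ((enorm (q - p))%:E <= eta3)%E ->
        e_min (enorm (q - p)) <= enorm (e q - e p))
    & (forall (q : 'cV[R]_(n * d)) (gamma : R -> 'cV[R]_(n * d)),
        {within `[0, 1], continuous gamma} ->
        gamma 0 = p -> gamma 1 = q ->
        (forall t, 0 <= t <= 1 -> translate p Csp (gamma t)) ->
        e q = e p -> 3 / 2 * eta1 < enorm (q - p) ->
        (eta2 <= (enorm (q - p))%:E)%E /\
        exists2 t : R, 0 <= t <= 1
          & (e_min_star <= (enorm (e (gamma t) - e p))%:E)%E)].
Proof.
move=> Rp Omega K Kk minK mu0 mubar L eta1 D hD eta2 eta3 e_min e_min_star e.
have [k0 [_ psdk]] := Kk.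
have eta10 : 0 <= eta1 by rewrite divr_ge0 ?mulr_ge0 ?enorm_ge0 // ltW.
have symA : (C^T *m Omega *m C)^T = C^T *m Omega *m C.
  by rewrite !trmx_mul trmxK stress_mx_sym mulmxA.
have symB : (C^T *m Rp^T *m Rp *m C)^T = C^T *m Rp^T *m Rp *m C.
  by rewrite !trmx_mul !trmxK !mulmxA.
have formK k x : (x^T *m (C^T *m Omega *m C + (2 * k) *: (C^T *m Rp^T *m Rp *m C)
      - lambda%:M) *m x) 0 0 =
    ((C *m x)^T *m Omega *m (C *m x)) 0 0
    + 2 * k * enorm (Rp *m (C *m x)) ^+ 2 - lambda * dot x x.
  rewrite form_shift mulmxDr mulmxDl -scalemxAr -scalemxAl.
  rewrite mxE; congr (_ + _ - _); first by rewrite trmx_mul !mulmxA.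
  by rewrite mxE sqr_enorm dotE !trmx_mul !mulmxA.
have stiff v : v \in Csp -> lambda * enorm v ^+ 2 <=
    (v^T *m Omega *m v) 0 0 + 2 * kappa * enorm (Rp *m v) ^+ 2.
  move=> /(orthonormal_basis_coord hC)[x vx dx].
  by have := psdk x; rewrite formK -vx -dx !sqr_enorm subr_ge0.
have curv v : v \in Csp -> (1 - mubar) * lambda * enorm v ^+ 2 <=
    (v^T *m Omega *m v) 0 0.
  move=> /(orthonormal_basis_coord hC)[x vx dx].
  have -> : (1 - mubar) * lambda = mu0 by rewrite /mubar; field; lra.
  have [x0|x0] := eqVneq x 0.
    by rewrite vx x0 mulmx0 sqr_enorm dotE !mulmx0 mxE mulr0.
  have := lambda_min_form symA x0.
  by rewrite sqr_enorm dx vx trmx_mul !mulmxA.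
(* failure of k = 0 exhibits a vector below lambda, which lies above mu0 *)
have m0 : 0 < kappa -> 0 <= mubar.
  move=> kp; rewrite leNgt; apply/negP => mneg.
  have : K 0.
    split=> //; split=> [|x].
      by rewrite mulr0 scale0r addr0 linearB /= symA tr_scalar_mx.
    rewrite mulr0 scale0r addr0 form_shift subr_ge0.
    have [->|x0] := eqVneq x 0.
      by rewrite mulmx0 mxE dotE mulmx0 mxE mulr0.
    apply: le_trans (lambda_min_form symA x0).
    rewrite ler_wpM2r ?dot_ge0 //.
    by move: mneg; rewrite subr_lt0 ltr_pdivlMr // mul1r => /ltW.
  by move/minK; rewrite leNgt kp.
(* without edges every k >= 0 would do, so the minimal one would be 0 *)
have z0 : 0 < kappa -> (0 : R) < (max_degree adj)%:R.
  move=> kp; rewrite ltr0n lt0n; apply/negP => /eqP zz.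
  have : K 0.
    split=> //; split=> [|x].
      by rewrite mulr0 scale0r addr0 linearB /= symA tr_scalar_mx.
    have := psdk x; rewrite !formK mulr0 mul0r.
    have -> : enorm (Rp *m (C *m x)) ^+ 2 = 0.
      rewrite sqr_enorm /dot big1 // => k _.
      have := enum_valP k; rewrite inE => /andP[adj12 _].
      have : (0 < max_degree adj)%N.
        apply: leq_trans (leq_bigmax (enum_val k).1).
        by apply/card_gt0P; exists (enum_val k).2.
      by rewrite zz.
    by rewrite mulr0.
  by move/minK; rewrite leNgt kp.
have L0 : 0 < kappa -> 0 < L.
  by move=> kp; rewrite sqrtr_gt0 divr_gt0 // !mulr_gt0 // z0.
have eL : 0 < kappa -> L ^+ 2 * (8 * (max_degree adj)%:R * kappa) = lambda.
  move=> kp; have zp := z0 kp; rewrite sqr_sqrtr.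
    by field; apply/andP; split; apply: lt0r_neq0.
  by rewrite divr_ge0 ?ltW // !mulr_gt0.
have D0 : 0 < kappa -> kappa == 0 = false by move=> kp; rewrite gt_eqF.
pose xi c := (Num.sqrt (mubar + c) - Num.sqrt mubar) / 2.
have eta3E : 0 < kappa -> eta3 = (L * xi (8 / 3))%:E.
  move=> kp; rewrite /eta3 /eta3_radius D0 // /eta3_val /xi; congr (_%:E); ring.
have partA : ((3 / 2 * eta1)%:E < eta3)%E.
  have [kz|kz] := eqVneq kappa 0.
    by rewrite /eta3 /eta3_radius kz eqxx ltry.
  have kp : 0 < kappa by rewrite lt0r kz.
  rewrite eta3E // lte_fin.
  have Lp := L0 kp; have mp := m0 kp; have := hD kp; rewrite /D /Dconst => hD'.
  have [|x0 ex] := @sqrt_gap R mubar (8 / 3) mp; first by lra.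
  rewrite -/(xi (8 / 3)) in x0 ex.
  have e2 : Num.sqrt mubar ^+ 2 = mubar by rewrite sqr_sqrtr.
  have eS : Num.sqrt (mubar + 8 / 3) = 2 * xi (8 / 3) + Num.sqrt mubar.
    by rewrite /xi; field.
  have s10 : 0 <= eta1 / L by rewrite divr_ge0 // ltW.
  have lt1 : eta1 / L < 2 / 3 * xi (8 / 3).
    apply: (@root_lt _ (Num.sqrt mubar) _ _ ((2 / 3 * xi (8 / 3)) ^+ 2
      + 2 / 3 * xi (8 / 3) * Num.sqrt mubar)) => //.
      by rewrite mulr_ge0.
    move: hD'; rewrite eS; move: e2 ex; set y := Num.sqrt mubar.
    by set x := xi _ => e2 ex; nra.
  by move: lt1; rewrite ltr_pdivrMr //; lra.
have grow v : v \in Csp -> ((enorm v)%:E <= eta3)%E ->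
    lambda / 3 * (enorm v ^+ 2 - 3 / 2 * eta1 * enorm v) <=
    enorm omega * enorm (e (p + v) - e p)
    + kappa / 2 * enorm (e (p + v) - e p) ^+ 2.
  move=> vC vle; apply: (@energy_growth _ _ _ _ _ _ _ _ _ _ _ _ _ mubar L) => //.
    exact: stiff.
  move=> kp; have Lp := L0 kp; have mp := m0 kp.
  split=> //; [exact: curv|exact: eL|].
  have [|x0 ex] := @sqrt_gap R mubar (8 / 3) mp; first by lra.
  apply: (@root_le _ _ _ (xi (8 / 3))) => //.
  - by rewrite divr_ge0 ?enorm_ge0 // ltW.
  - by rewrite ex; field.
  by move: vle; rewrite eta3E // lee_fin ler_pdivrMr // mulrC.
have partB q : translate p Csp q ->
    3 / 2 * eta1 < enorm (q - p) -> ((enorm (q - p))%:E <= eta3)%E ->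
    e_min (enorm (q - p)) <= enorm (e q - e p).
  case=> v /= vC <-; rewrite addrAC subrr add0r => Nlo Nhi.
  have := grow v vC Nhi; set N := enorm v in Nlo *; set y := enorm (_ - _).
  have N0 : 0 < N by lra.
  have NN : N ^+ 2 * (1 - 3 / 2 * (eta1 / N)) = N ^+ 2 - 3 / 2 * eta1 * N.
    by field; lra.
  have y0 : 0 <= y by exact: enorm_ge0.
  have w0 : 0 <= enorm omega by exact: enorm_ge0.
  rewrite /e_min /emin; have [kz|kz] := eqVneq kappa 0.
    rewrite kz !mul0r addr0 => h; rewrite -[_ * N ^+ 2 * _]mulrA NN.
    have [wz|wz] := eqVneq (enorm omega) 0.
      by rewrite wz invr0 !(mulr0, mul0r).
    have wp : 0 < enorm omega by rewrite lt0r wz.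
    have -> : 1 / 3 * (lambda / enorm omega) * (N ^+ 2 - 3 / 2 * eta1 * N) =
        lambda / 3 * (N ^+ 2 - 3 / 2 * eta1 * N) / enorm omega by field.
    by rewrite ler_pdivrMr // [leRHS]mulrC.
  have kp : 0 < kappa by rewrite lt0r kz.
  move/(quadratic_lb kp w0 y0); congr (Num.sqrt (_ + _) - _ <= _).
  by rewrite -[_ * N ^+ 2 * _]mulrA NN; field.
split=> // q gamma gc g0 g1 gC eqp Nlo.
have far v : v \in Csp -> e (p + v) = e p -> 3 / 2 * eta1 < enorm v ->
    0 < kappa /\ 8 / 3 * L ^+ 2 < enorm v ^+ 2.
  move=> vC ev vlo.
  have := @equilibrium_far _ _ _ _ _ _ _ _ adj_sym hlambda0 k0 _ (stiff v vC) ev vlo.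
  have [kz|kz] := eqVneq kappa 0.
    by rewrite kz mulr0 !mul0r ltNge (ltW hlambda0).
  have kp : 0 < kappa by rewrite lt0r kz.
  move=> h; split=> //; rewrite -{1}(eL kp) in h.
  have zk : 0 < (max_degree adj)%:R * kappa by rewrite mulr_gt0 // z0.
  rewrite -(ltr_pM2r zk); lra.
have [kp sfar] : 0 < kappa /\ 8 / 3 * L ^+ 2 < enorm (q - p) ^+ 2.
  have : translate p Csp q by rewrite -g1; apply: gC; rewrite ler01 lexx.
  case=> v /= vC vq; move: Nlo eqp; rewrite -vq addrAC subrr add0r => vlo ev.
  exact: far.
have Lp := L0 kp; have mp := m0 kp.
(* both eta2 and eta3 are at most L *)
have xi_le c : 0 <= c -> c <= 4 -> L * xi c <= L.
  move=> c0 c4; have [x0 ex] := sqrt_gap mp c0.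
  rewrite ger_pMr //; rewrite -/(xi c) in x0 ex.
  have := sqrtr_ge0 mubar; set y := Num.sqrt _ in ex * => y0; nra.
have LN : L <= enorm (q - p).
  rewrite -(@ler_pXn2r _ 2) ?nnegrE ?enorm_ge0 ?(ltW Lp) //.
  by have := sqr_ge0 L; lra.
split.
  rewrite /eta2 /eta2_radius D0 //; case: ifP => _; rewrite lee_fin.
    by have := xi_le 4 (ler0n _ _) (lexx _); rewrite /xi; lra.
  by have := xi_le 2 (ler0n _ _) (ler_nat _ 2 4); rewrite /xi; lra.
have cN : {within `[0, 1], continuous (fun t => enorm (gamma t - p))}.
  have cp : continuous (fun u : 'cV[R]_(n * d) => u - p).
    by move=> u; apply: continuousB; [exact: cvg_id|exact: cst_continuous].
  apply: (@within_continuous_comp _ _ _ _ gamma (fun u => enorm (u - p))) => //.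
  move=> u _; have := continuous_comp (cp u) (@enorm_continuous R _ (u - p)).
  exact.
have x83 : L * xi (8 / 3) <= enorm (q - p).
  by apply: le_trans LN; apply: xi_le; lra.
have g0p : enorm (gamma 0 - p) = 0.
  by rewrite g0 subrr /enorm /dot big1 ?sqrtr0 // => i _; rewrite mxE mul0r.
have x830 : 0 <= L * xi (8 / 3).
  have [|x0 _] := @sqrt_gap R mubar (8 / 3) mp; first by lra.
  by rewrite mulr_ge0 // ltW.
have [|t t01 et] := IVT (v := L * xi (8 / 3)) ler01 cN.
  by rewrite g0p g1 min_l ?enorm_ge0 // max_r ?enorm_ge0 // x830.
rewrite in_itv /= in t01; exists t => //.
rewrite /e_min_star /emin_star D0 // lee_fin.
have -> : eta3_val L mubar = enorm (gamma t - p).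
  by rewrite et /eta3_val /xi; ring.
apply: partB; first exact: gC.
  by move: partA; rewrite eta3E // lte_fin et.
by rewrite eta3E // lee_fin et.
Qed.
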